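(* Let $z,q\in\mathbb C$ with $|q|<\frac{1}{1+|z|}$. (1) For every integer $k\ge 1$, the generating function $M_k(z;q)$ for the set $\mathcal M_k$ of multimodal sequences with $k$-fold peak is given by $$M_k(z;q)=\sum_{n\geq 1}\frac{z^k q^{kn}}{\{zq;q\}_{n-1}^{k-1}\,(zq;q)_{n-1}^2}=\sum_{\mu\in\mathcal{M}_k}z^{\ell(\mu)}q^{|\mu|}.$$ (2) The generating function $M(z;q)$ for the set $\mathcal M$ of all multimodal sequences is given by $$M(z;q)=\sum_{k\geq 1}\sum_{n\geq 1}\frac{z^k q^{kn}}{\{zq;q\}_{n-1}^{k-1}\,(zq;q)_{n-1}^2}=\sum_{\mu\in\mathcal{M}}z^{\ell(\mu)}q^{|\mu|}.$$
   Context: Notation: $(z;q)_n:=\prod_{i=0}^{n-1}(1-zq^i)$ (with $(z;q)_0=1$), and $\{z;q\}_0:=1$, $\{z;q\}_n:=1-z\sum_{i=0}^{n-1}q^i$ for $n\ge1$. So $\{zq;q\}_n=1-z\sum_{i=1}^{n}q^i$. A multimodal sequence with $k$-fold peak ($k\ge 1$) is a finite nonempty sequence of positive integers whose maximum value $n$ (the peak value) occurs exactly $k$ times, such that the (possibly empty) part before the first occurrence of $n$ (the left-hand partition) is weakly increasing, and the (possibly empty) part after the last occurrence of $n$ (the right-hand partition) is weakly decreasing. All entries other than the $k$ peaks are $<n$. The $k-1$ subsequences between consecutive occurrences of $n$ are arbitrary, possibly empty, finite sequences of positive integers $<n$ (compositions into parts $<n$). $\mathcal M_k$ is the set of multimodal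 sequences with $k$-fold peak, and $\mathcal M=\bigcup_{k\ge1}\mathcal M_k$. For a sequence $\mu$, $\ell(\mu)$ is its length (number of terms) and $|\mu|$ is its size (sum of terms). *)

(* Defs.v *)
From HB Require Import structures.
From mathcomp Require Import all_boot all_order all_algebra finmap.
From mathcomp Require Import complex.
From mathcomp Require Import boolp classical_sets reals topology normedtype.
From mathcomp Require Import sequences.
From mathcomp.analysis.showcase Require Import summability.

Set Implicit Arguments.
Unset Strict Implicit.
Unset Printing Implicit Defensive.

Import Order.TTheory GRing.Theory Num.Theory.
Import numFieldNormedType.Exports.

Local Open Scope classical_set_scope.
Local Open Scope ring_scope.

Notation "\sum_ ( m <= i <oo ) F" :=
  (\big[+%R/0%R]_(m <= i <oo) F%R) : ring_scope.

(* MathComp-Analysis attaches the norm topology to every [K : numFieldType],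
   but [R[i]] itself does not unify with [Num.NumField.sort _]; packaging it
   as a [numFieldType] makes that topology on the complex numbers available. *)
Definition Cplx (R : realType) : numFieldType := R[i].

Section Pochhammer.
Variable K : numFieldType.

Definition qpoch (z q : K) (n : nat) : K := \prod_(0 <= i < n) (1 - z * q ^+ i).

(* {z; q}_n ; the empty sum gives {z; q}_0 = 1 *)
Definition qbrace (z q : K) (n : nat) : K := 1 - z * \sum_(0 <= i < n) q ^+ i.

(* The sequences with [k] peaks of value [n] contribute this term: one factor
   qbrace per gap between peaks, one factor qpoch for each outer partition.
   Only used for [k, n >= 1]. *)
Definition peak_term (z q : K) (k n : nat) : K :=
  z ^+ k * q ^+ (k * n) /
    (qbrace (z * q) q n.-1 ^+ k.-1 * qpoch (z * q) q n.-1 ^+ 2).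

End Pochhammer.

Definition peak (mu : seq nat) : nat := (\max_(a <- mu) a)%N.

Definition left_part (mu : seq nat) : seq nat := take (index (peak mu) mu) mu.

(* The entries after the last occurrence of the peak value, which is the first
   occurrence in [rev mu]. *)
Definition right_part (mu : seq nat) : seq nat := rev (left_part (rev mu)).

Definition multimodal_k (k : nat) : set (seq nat) :=
  [set mu | [&& mu != [::], all (fun a => (0 < a)%N) mu,
                count_mem (peak mu) mu == k,
                sorted leq (left_part mu) & sorted geq (right_part mu)]].

Definition multimodal : set (seq nat) :=
  \bigcup_(k in [set k | (0 < k)%N]) multimodal_k k.

Section GeneratingFunction.
Variables (R : realType) (A : set (seq nat)) (z q : Cplx R).

Definition weight (mu : A) : Cplx R :=
  z ^+ size (val mu) * q ^+ sumn (val mu).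

(* Sums over [A] are unconditional: limits of the finite partial sums along the
   directed set of finite subsets of [A]. *)
Definition genfun_cvg : Prop :=
  cvg (partial_sum weight @ totally).

Definition genfun : Cplx R := lim (partial_sum weight @ totally).

End GeneratingFunction.

(* Main.v *)
(* All the words involved have positive letters, and the hypothesis on [q] says
   exactly that the absolute weights of the one-letter words add up to
   [|z| |q| / (1 - |q|) < 1]; hence the weights of all words of positive letters
   are absolutely summable, and A |-> (sum of the weights over A) is countably
   additive on sets of such words.  Prepending a letter [a] multiplies a sum by
   [z q^a], so splitting words by their first letter turns each set of words
   into a linear equation for its sum, with coefficient [1 - z q^a] or
   [1 - \sum_a z q^a]: decreasing words with letters at most [n], words with [k]
   occurrences of [n] and decreasing after the last one, and finally the same
   preceded by an increasing word.  No product of infinite sums is needed. *)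

Require Import Defs.
From HB Require Import structures.
From mathcomp Require Import all_boot all_order all_algebra finmap.
From mathcomp Require Import complex.
From mathcomp Require Import boolp classical_sets reals topology normedtype.
From mathcomp Require Import sequences.
From mathcomp.analysis.showcase Require Import summability.

Set Implicit Arguments.
Unset Strict Implicit.
Unset Printing Implicit Defensive.

Import Order.TTheory GRing.Theory Num.Theory.
Import numFieldNormedType.Exports.

Local Open Scope classical_set_scope.
Local Open Scope ring_scope.

(* [summability] declares this instance inside a section, so it is not exported. *)
#[local] Existing Instance totally_filter.

(** * Unconditional sums *)

Definition abs_bounded (I : choiceType) (K : numFieldType) (f : I -> K) : Prop :=
  exists M : K, forall J : {fset I}, \sum_(i <- J) `|f i| <= M.

Lemma partial_sumE (I : choiceType) (K : zmodType) (f : I -> K) (J : {fset I}) :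
  partial_sum f J = \sum_(i <- J) f i.
Proof. by rewrite /partial_sum -(big_seq_fsetE _ J xpredT f). Qed.

(** Multiplicities in [s] are at most those in [t], so [t] is a permutation of [s] followed by extra
    entries, whose terms are nonnegative. *)
Lemma uniq_sum_le (I : eqType) (K : numFieldType) (g : I -> K) (s t : seq I) :
  (forall i, 0 <= g i) -> uniq s -> {subset s <= t} ->
  \sum_(i <- s) g i <= \sum_(i <- t) g i.
Proof.
move=> g_ge0 uniq_s sub_st.
have /count_subseqP[s' /perm_to_subseq[r perm_t] perm_s] i :
    (count_mem i s <= count_mem i t)%N.
  rewrite count_uniq_mem //; case: (boolP (i \in s)) => // /sub_st.
  by rewrite -has_pred1 has_count.
by rewrite (perm_big _ perm_t) (perm_big _ perm_s) big_cat lerDl sumr_ge0.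
Qed.

Lemma totallyP (I : choiceType) (P : set {fset I}) (J0 : {fset I}) :
  (forall J, (J0 `<=` J)%fset -> P J) -> \forall J \near totally, P J.
Proof. by move=> h; exists J0. Qed.

(** The partial sums increase with the finite set and are bounded, so they converge to their
    supremum. *)
Lemma nonneg_sum_cvg (R : realType) (I : choiceType) (g : I -> R) :
  (forall i, 0 <= g i) -> abs_bounded g -> cvg (partial_sum g @ totally).
Proof.
move=> g_ge0 [M leM].
pose E := range (partial_sum g).
have supE : has_sup E.
  split; first by exists (partial_sum g fset0); exists fset0.
  exists M => _ [J _ <-]; rewrite partial_sumE; apply: le_trans (leM J).
  by apply: ler_sum => i _; rewrite ger0_norm.
apply/cvg_ex; exists (sup E); apply/cvgrPdist_lt => /= eps eps_gt0.
have [_ [J0 _ <-] ltJ0] := sup_adherent eps_gt0 supE.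
apply: (@totallyP _ _ J0) => J sJ.
have leE : partial_sum g J <= sup E by apply: ub_le_sup; [case: supE | exists J].
have leJ : partial_sum g J0 <= partial_sum g J.
  by rewrite !partial_sumE uniq_sum_le ?fset_uniq //; exact/fsubsetP.
by rewrite ger0_norm ?subr_ge0 // ltrBlDl -ltrBlDr (lt_le_trans ltJ0).
Qed.

Lemma partial_sumD (I : choiceType) (K : zmodType) (f g : I -> K) :
  partial_sum (fun i => f i + g i) = (fun J => partial_sum f J + partial_sum g J).
Proof. by apply/funext => J; rewrite /partial_sum big_split. Qed.

Lemma partial_sumB (I : choiceType) (K : zmodType) (f g : I -> K) :
  partial_sum (fun i => f i - g i) = (fun J => partial_sum f J - partial_sum g J).
Proof. by apply/funext => J; rewrite /partial_sum sumrB. Qed.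

(** The family is the difference of the nonnegative families [f + |f|] and [|f|], both with bounded
    partial sums. *)
Lemma real_sum_cvg (R : realType) (I : choiceType) (f : I -> R) :
  abs_bounded f -> cvg (partial_sum f @ totally).
Proof.
move=> [M leM].
have abs_cvg : cvg (partial_sum (fun i => `|f i|) @ totally).
  apply: nonneg_sum_cvg => //; exists M => J.
  by under eq_bigr do rewrite normr_id.
have sum_cvg : cvg (partial_sum (fun i => f i + `|f i|) @ totally).
  apply: nonneg_sum_cvg => [i|].
    by rewrite -lerBlDl sub0r -normrN ler_norm.
  exists (M + M) => J; apply: le_trans (lerD (leM J) (leM J)).
  rewrite -big_split /=; apply: ler_sum => i _.
  by apply: le_trans (ler_normD _ _) _; rewrite normr_id.
have -> : f = (fun i => (f i + `|f i|) - `|f i|).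
  by apply/funext => i; rewrite addrK.
rewrite partial_sumB; apply/cvg_ex.
exists (lim (partial_sum (fun i => f i + `|f i|) @ totally)
        - lim (partial_sum (fun i => `|f i|) @ totally)).
exact: cvgB.
Qed.

(** * Absolutely bounded complex families *)

Section ComplexSums.
Variables (R : realType) (I : choiceType).
Implicit Types f g : I -> Cplx R.

Lemma normcR (x : R) : `|x%:C%C : Cplx R| = `|x|%:C%C.
Proof. by rewrite [LHS]normc_def /= expr0n addr0 sqrtr_sqr. Qed.

Lemma partial_sum_real_complex (h : I -> R) (a : R) :
  partial_sum h @ totally --> a ->
  partial_sum (fun i => (h i)%:C%C : Cplx R) @ totally --> (a%:C%C : Cplx R).
Proof.
move=> /cvgrPdist_lt h_cvg; apply/cvgrPdist_lt => /= eps eps_gt0.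
(* A positive element of [R[i]] is real, so [eps] comes from a real tolerance. *)
have epsE : (complex.Re eps)%:C%C = eps by exact/RRe_real/gtr0_real.
move: eps_gt0; rewrite -epsE ltcR => /h_cvg; apply: filterS => J.
have -> : partial_sum (fun i => (h i)%:C%C : Cplx R) J = (partial_sum h J)%:C%C.
  by rewrite /partial_sum rmorph_sum.
by rewrite -[_%:C%C - _]rmorphB normcR ltcR.
Qed.

(** Real and imaginary parts are dominated by the modulus, so the real case applies to each of
    them. *)
Lemma complex_sum_cvg f : abs_bounded f -> cvg (partial_sum f @ totally).
Proof.
move=> [M leM].
have part_cvg (part : Cplx R -> R) :
    (forall x, `|part x|%:C%C <= `|x|) ->
    cvg (partial_sum (fun i => part (f i)) @ totally).
  move=> le_part; apply: real_sum_cvg; exists (complex.Re M) => J.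
  have leJ := leM J.
  (* The bound [M] is a priori complex; dominating a nonnegative sum makes it real. *)
  rewrite -lecR; have -> : (complex.Re M)%:C%C = M.
    by apply/RRe_real/ger0_real; apply: le_trans leJ; apply: sumr_ge0.
  apply: le_trans leJ; rewrite rmorph_sum; apply: ler_sum => i _; exact: le_part.
have Re_cvg := part_cvg _ (@normc_ge_Re R).
have le_Im (x : Cplx R) : `|complex.Im x|%:C%C <= `|x|.
  by rewrite [leRHS]normc_def lecR -sqrtr_sqr ler_wsqrtr // lerDr sqr_ge0.
have Im_cvg := part_cvg _ le_Im.
have -> : f = fun i => (complex.Re (f i))%:C%C + 'i%C * (complex.Im (f i))%:C%C.
  by apply/funext => i; exact: complexE.
rewrite partial_sumD.
have -> : partial_sum (fun i => 'i%C * (complex.Im (f i))%:C%C) =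
    fun J => 'i%C * partial_sum (fun i => (complex.Im (f i))%:C%C) J.
  by apply/funext => J; rewrite /partial_sum mulr_sumr.
apply/cvg_ex; eexists; apply: cvgD.
  exact: partial_sum_real_complex Re_cvg.
apply: cvgMl_tmp.
exact: partial_sum_real_complex Im_cvg.
Qed.

End ComplexSums.

(** * Countable additivity of sums over sets *)

Section SetSums.
Variables (R : realType) (I : choiceType) (f : I -> Cplx R).
Implicit Types A B D : set I.

(** Extension by zero puts the sums over all subsets on one index type, where they can be added
    termwise. *)
Definition restr A (i : I) : Cplx R := if i \in A then f i else 0.

Definition set_sum A : Cplx R := lim (partial_sum (restr A) @ totally).

Hypothesis f_bounded : abs_bounded f.

(** Cauchy criterion for the absolute values: beyond [J0] all partial sums are within [eps / 2] of
    the limit, so adjoining a set disjoint from [J0] changes them by less than [eps]. *)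
Lemma sum_tail (eps : Cplx R) : 0 < eps -> exists J0 : {fset I},
  forall J : {fset I}, (forall i, i \in J -> i \notin J0) ->
  \sum_(i <- J) `|f i| < eps.
Proof.
move=> eps_gt0; have [M leM] := f_bounded.
have /cvg_ex[l /cvgrPdist_lt abs_cvg] :
    cvg (partial_sum (fun i => `|f i|) @ totally).
  apply: complex_sum_cvg; exists M => J.
  by under eq_bigr do rewrite normr_id.
have /abs_cvg [J0 _ nearJ0] : 0 < eps / 2 by rewrite divr_gt0.
exists J0 => J disjJ.
have := ler_distD l (partial_sum (fun i => `|f i|) (J0 `|` J)%fset)
  (partial_sum (fun i => `|f i|) J0).
have sumU : partial_sum (fun i => `|f i|) (J0 `|` J)%fset
    = partial_sum (fun i => `|f i|) J0 + \sum_(i <- J) `|f i|.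
  rewrite !partial_sumE -big_cat; apply: perm_big.
  apply: uniq_perm => [||i]; rewrite ?fset_uniq ?cat_uniq ?fset_uniq ?andbT //=.
    by apply/hasPn.
  by rewrite inE mem_cat.
rewrite {1}sumU addrAC subrr add0r ger0_norm ?sumr_ge0 // => /le_lt_trans; apply.
rewrite [ltRHS]splitr; apply: ltrD; last by apply: nearJ0 => /=; exact: fsubset_refl.
by rewrite distrC; apply: nearJ0 => /=; exact: fsubsetUl.
Qed.

Lemma restr_norm_le A i : `|restr A i| <= `|f i|.
Proof. by rewrite /restr; case: ifP => // _; rewrite normr0. Qed.

Lemma set_sum_cvg A : partial_sum (restr A) @ totally --> set_sum A.
Proof.
apply: complex_sum_cvg; have [M leM] := f_bounded; exists M => J.
by apply: le_trans (leM J); apply: ler_sum => i _; exact: restr_norm_le.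
Qed.

Lemma set_sum_lim A (l : Cplx R) :
  partial_sum (restr A) @ totally --> l -> set_sum A = l.
Proof. by move=> /cvg_lim; apply; exact: norm_hausdorff. Qed.

Lemma set_sum0 : set_sum set0 = 0.
Proof.
apply: set_sum_lim; have -> : partial_sum (restr set0) = fun=> 0.
  by apply/funext => J; apply: big1 => i _; rewrite /restr in_set0.
exact: cvg_cst.
Qed.

Lemma set_sumU A B : A `&` B = set0 -> set_sum (A `|` B) = set_sum A + set_sum B.
Proof.
move=> disjAB; apply: set_sum_lim.
have -> : restr (A `|` B) = fun i => restr A i + restr B i.
  apply/funext => i; rewrite /restr in_setU.
  case: (boolP (i \in A)) => iA; case: (boolP (i \in B)) => iB;
    rewrite ?addr0 ?add0r //.
  have : (A `&` B) i by split; exact/set_mem.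
  by rewrite disjAB.
by rewrite partial_sumD; apply: cvgD; exact: set_sum_cvg.
Qed.

Lemma set_sum1 (i : I) : set_sum [set i] = f i.
Proof.
apply: set_sum_lim => P /nbhs_singleton Pfi; apply: (@totallyP _ _ [fset i]%fset).
move=> J; rewrite fsub1set => iJ /=; rewrite partial_sumE (bigD1_seq i) ?fset_uniq //=.
rewrite big1 ?addr0 => [|j ji]; first by rewrite /restr mem_set.
rewrite /restr ifF //; apply/negbTE; apply: contraNN ji => /set_mem /= ->.
exact: eqxx.
Qed.

Lemma set_sum_bigcup_finite (A : nat -> set I) (m N : nat) : trivIset setT A ->
  set_sum (\bigcup_(n in [set n | (m <= n < N)%N]) A n)
    = \sum_(m <= n < N) set_sum (A n).
Proof.
move=> trivA; apply/esym; elim: N => [|N IHN].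
  rewrite big_geq // -set_sum0; congr set_sum; apply/esym.
  by rewrite -subset0 => i [n /=]; rewrite ltn0 andbF.
have [lemN|ltNm] := leqP m N; last first.
  rewrite big_geq // -set_sum0; congr set_sum; apply/esym.
  rewrite -subset0 => i [n /= /andP[lemn ltnN]].
  by have := leq_trans ltNm lemn; rewrite ltnNge -ltnS ltnN.
rewrite big_nat_recr //= IHN -set_sumU.
  congr set_sum; apply/seteqP; split => i.
    move=> [[n /= /andP[lemn ltnN] Ani]|ANi]; last by exists N; rewrite /= ?lemN /=.
    by exists n => //=; rewrite lemn ltnW.
  move=> [n /= /andP[lemn]]; rewrite ltnS leq_eqVlt => /orP[/eqP -> |ltnN] Ani.
    by right.
  by left; exists n => //=; rewrite lemn.
rewrite -subset0 => i [[n /= /andP[_ ltnN] Ani] ANi].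
have /trivIsetP /(_ n N Logic.I Logic.I) := trivA.
by rewrite neq_ltn ltnN => /(_ isT) An0; have : (A n `&` A N) i by []; rewrite An0.
Qed.

(** By finite additivity the error at stage [N] is the sum over [V] minus [B N]. For large [N] this
    remainder avoids the finite set [J0] that carries all but a small part of the absolute sum. *)
Lemma set_sum_bigcup (A : nat -> set I) (U : set I) (m : nat) :
  trivIset setT A -> U = \bigcup_(n in [set n | (m <= n)%N]) A n ->
  (fun N => \sum_(m <= n < N) set_sum (A n)) @ \oo --> set_sum U.
Proof.
move=> trivA ->; set V := \bigcup_(n in _) A n.
pose B N := \bigcup_(n in [set n | (m <= n < N)%N]) A n.
have -> : (fun N => \sum_(m <= n < N) set_sum (A n)) = set_sum \o B.
  by apply/funext => N /=; rewrite set_sum_bigcup_finite.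
apply/cvgrPdist_lt => /= eps eps_gt0.
have eps2_gt0 : 0 < eps / 2 by rewrite divr_gt0.
have [J0 tailJ0] := sum_tail eps2_gt0.
(* Each of the finitely many elements of [J0] lying in [V] belongs to some [A n]; [N0] exceeds all
   these indices. *)
have [N0 subN0] : exists N0, forall i, i \in J0 -> V i -> B N0 i.
  have: forall s : seq I, exists N0, forall i, i \in s -> V i -> B N0 i.
    elim=> [|j s [N1 subN1]]; first by exists 0%N.
    have [[n lemn Anj]|notVj] := pselect (V j); last first.
      by exists N1 => i; rewrite inE => /orP[/eqP -> //|]; exact: subN1.
    exists (maxn N1 n.+1) => i; rewrite inE => /orP[/eqP -> _|/subN1 + Ui].
      by exists n => //=; rewrite lemn /= leq_max ltnS leqnn orbT.
    move=> /(_ Ui) [n' /= /andP[lemn' ltn'] An'i]; exists n' => //=.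
    by rewrite lemn' leq_max ltn'.
  exact.
near=> N.
have leN0 : (N0 <= N)%N by near: N; exact: nbhs_infty_ge.
have -> : V = B N `|` (V `\` B N).
  by rewrite setDUK // => i [n /= /andP[lemn _] Ani]; exists n.
rewrite set_sumU; last by rewrite setDE setICA setICr setI0.
rewrite addrC addKr.
(* One half of [eps] pays for replacing the remainder by its partial sum over [J1], the other for
   that partial sum, to which [J0] contributes only zeros. *)
have /cvgrPdist_lt /(_ _ eps2_gt0) [J1 _ nearJ1] := @set_sum_cvg (V `\` B N).
have nearJ01 := nearJ1 J1 (fsubset_refl _).
rewrite -[set_sum _](subrK (partial_sum (restr (V `\` B N)) J1)) [ltRHS]splitr.
apply: le_lt_trans (ler_normD _ _) _; apply: ltrD => //.
rewrite partial_sumE; apply: le_lt_trans (ler_norm_sum _ _ _) _.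
rewrite (bigID (mem J0)) /= big1_seq ?add0r => [|i /andP[iJ0 _]]; last first.
  rewrite /restr ifF ?normr0 //; apply/negbTE/negP => /set_mem [Ui]; apply.
  have [n /= /andP[lemn ltn] Ani] := subN0 i iJ0 Ui.
  by exists n => //=; rewrite lemn (leq_trans ltn).
apply: le_lt_trans (tailJ0 [fset i in J1 | i \notin J0]%fset _).
  by rewrite big_fset_condE /=; apply: ler_sum => i _; exact: restr_norm_le.
by move=> i; rewrite !inE => /andP[].
Unshelve. all: by end_near.
Qed.

End SetSums.

(** * Reindexing along an injection *)

Lemma fset_preimage (I J : choiceType) (h : I -> J) (s : seq J) : injective h ->
  exists I0 : {fset I}, forall i, (i \in I0) = (h i \in s).
Proof.
move=> h_inj; elim: s => [|j s [I0 memI0]]; first by exists fset0 => i; rewrite inE.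
have [[i0 <-]|not_im] := pselect (exists i, h i = j).
  by exists (i0 |` I0)%fset => i; rewrite !inE memI0 (inj_eq h_inj).
exists I0 => i; rewrite inE memI0; case: eqVneq => // hij.
by case: not_im; exists i.
Qed.

(** As [f] vanishes off the image of [h], its partial sum over [J0] is that of [f \o h] over the
    preimage of [J0], and this preimage contains [I0] as soon as [J0] contains the image of [I0]. *)
Lemma partial_sum_reindex (K : numFieldType) (I J : choiceType) (h : I -> J)
    (f : J -> K) (l : K) :
  injective h -> (forall j, f j != 0 -> exists i, h i = j) ->
  partial_sum (f \o h) @ totally --> l -> partial_sum f @ totally --> l.
Proof.
move=> h_inj supp_f fh_cvg P /fh_cvg [I0 _ PI0].
apply: (@totallyP _ _ (h @` I0)%fset) => J0 sJ0 /=.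
have [I1 memI1] := fset_preimage J0 h_inj.
have -> : partial_sum f J0 = partial_sum (f \o h) I1.
  rewrite !partial_sumE -[RHS](big_map h xpredT f) [LHS](bigID (mem (map h I1))) /=.
  rewrite [X in _ + X]big1_seq ?addr0 => [|j /andP[notim jJ0]]; last first.
    apply/eqP; apply: contraNT notim => /supp_f [i hij].
    by apply/mapP; exists i => //; rewrite memI1 hij.
  rewrite -big_filter; apply: perm_big; apply: uniq_perm => [||j].
  - by rewrite filter_uniq ?fset_uniq.
  - by rewrite map_inj_uniq ?fset_uniq.
  - rewrite mem_filter; case: (boolP (j \in map h I1)) => //= /mapP[k].
    by rewrite memI1 => ? ->.
apply: PI0 => /=; apply/fsubsetP => i iI0; rewrite memI1.
by apply: (fsubsetP sJ0); apply/imfsetP; exists i.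
Qed.

(** * Words of positive letters *)

Section Words.
Variables (R : realType) (z q : Cplx R).
Hypothesis hq : `|q| < 1 / (1 + `|z|).

Definition positive_word (u : seq nat) : bool := all (fun a => (0 < a)%N) u.

(* Vanishing off positive words makes [word_weight] absolutely summable on the
   whole type [seq nat]. *)
Definition word_weight (u : seq nat) : Cplx R :=
  if positive_word u then z ^+ size u * q ^+ sumn u else 0.

Lemma word_weight_cons (a : nat) (u : seq nat) : (0 < a)%N ->
  word_weight (a :: u) = z * q ^+ a * word_weight u.
Proof.
move=> a_gt0; rewrite /word_weight /= a_gt0 /=; case: ifP => _; last by rewrite mulr0.
by rewrite exprS exprD mulrACA.
Qed.

(** The hypothesis on [q] cleared of its denominator; it yields both [|q| < 1] and
    [letter_ratio < 1]. *)
Lemma norm_zq : `|z| * `|q| < 1 - `|q|.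
Proof.
have z1_gt0 : 0 < 1 + `|z| by rewrite ltr_wpDr.
move: hq; rewrite ltr_pdivlMr // mulrDr mulr1.
by rewrite ltrBrDl [X in _ + X]mulrC.
Qed.

Lemma one_sub_norm_gt0 : 0 < 1 - `|q|.
Proof. by apply: le_lt_trans norm_zq; rewrite mulr_ge0. Qed.

(** The value of the geometric series of all [|z q^a|] with [a >= 1]. *)
Definition letter_ratio : Cplx R := `|z| * `|q| / (1 - `|q|).

Lemma letter_ratio_lt1 : letter_ratio < 1.
Proof. by rewrite ltr_pdivrMr ?one_sub_norm_gt0 // mul1r norm_zq. Qed.

Lemma letters_norm_le (n : nat) :
  \sum_(1 <= a < n) `|z * q ^+ a| <= letter_ratio.
Proof.
rewrite ler_pdivlMr ?one_sub_norm_gt0 // big_add1.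
under eq_bigr do rewrite normrM normrX exprS mulrA.
rewrite -mulr_sumr -mulrA ler_piMr ?mulr_ge0 //.
(* The finite geometric sum times [1 - |q|] is one minus a power of [|q|]. *)
rewrite big_mkord mulrC -opprB mulNr -subrX1 opprB lerBlDr lerDl.
by rewrite exprn_ge0.
Qed.

(** This gives the nonvanishing of the [qbrace] denominators. *)
Lemma letters_neq1 (n : nat) : 1 - \sum_(1 <= a < n) z * q ^+ a != 0.
Proof.
rewrite subr_eq0; apply/eqP => sum1.
have : `|\sum_(1 <= a < n) z * q ^+ a| < 1.
  apply: le_lt_trans (ler_norm_sum _ _ _) _.
  exact: le_lt_trans (letters_norm_le n) letter_ratio_lt1.
by rewrite -sum1 normr1 ltxx.
Qed.

(** This gives the nonvanishing of the [qpoch] denominators: a letter of weight 1 would by itself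
    push the sum of norms above [letter_ratio]. *)
Lemma letter_neq1 (a : nat) : (0 < a)%N -> 1 - z * q ^+ a != 0.
Proof.
move=> a_gt0; rewrite subr_eq0; apply/eqP => letter1.
have := letters_norm_le a.+1.
rewrite big_nat_recr //= -letter1 normr1 => /le_lt_trans /(_ letter_ratio_lt1).
by rewrite gtrDr => /lt_geF; rewrite sumr_ge0.
Qed.

(** Boxes of words with bounded length and letters: they exhaust the positive words, and splitting
    off the first letter makes their absolute sums recursive in [L]. *)
Fixpoint word_box (n L : nat) : seq (seq nat) :=
  if L is L'.+1 then [::] :: [seq a :: u | a <- index_iota 1 n, u <- word_box n L']
  else [:: [::]].

Lemma mem_word_box (n L : nat) (u : seq nat) :
  (size u <= L)%N -> all (fun a => 0 < a < n)%N u -> u \in word_box n L.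
Proof.
elim: L u => [|L IHL] [|a u] //= szu /andP[an un].
rewrite inE /=; apply/allpairsP; exists (a, u).
by rewrite mem_index_iota; split => //; exact: IHL.
Qed.

(** With [r] the letter ratio, the absolute sums satisfy [S (L+1) <= 1 + r * S L], and [1 / (1 - r)]
    is the fixed point of [x = 1 + r * x]. *)
Lemma word_box_bound (n L : nat) :
  \sum_(u <- word_box n L) `|word_weight u| <= 1 / (1 - letter_ratio).
Proof.
have ratio_gt0 : 0 < 1 - letter_ratio by rewrite subr_gt0 letter_ratio_lt1.
have ratio_ge0 : 0 <= letter_ratio.
  by rewrite divr_ge0 ?mulr_ge0 // ltW ?one_sub_norm_gt0.
have nil1 : `|word_weight [::]| = 1 by rewrite /word_weight /= !expr0 mulr1 normr1.
elim: L => [|L IHL] /=.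
  by rewrite big_seq1 nil1 ler_pdivlMr // mul1r lerBlDr lerDl.
rewrite big_cons nil1 big_allpairs_dep /=.
have -> : \sum_(a <- index_iota 1 n) \sum_(u <- word_box n L) `|word_weight (a :: u)|
  = (\sum_(1 <= a < n) `|z * q ^+ a|) * \sum_(u <- word_box n L) `|word_weight u|.
  rewrite mulr_suml; apply: eq_big_nat => a /andP[a_gt0 _]; rewrite mulr_sumr.
  by apply: eq_bigr => u _; rewrite word_weight_cons // normrM.
apply: (@le_trans _ _ (1 + letter_ratio * (1 / (1 - letter_ratio)))).
  rewrite lerD2l; apply: ler_pM => //; first exact: sumr_ge0.
    exact: sumr_ge0.
  exact: letters_norm_le.
by rewrite -[X in X + _](divff (lt0r_neq0 ratio_gt0)) !mul1r -mulrDl subrK mul1r.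
Qed.

Lemma word_weight_bounded : abs_bounded word_weight.
Proof.
exists (1 / (1 - letter_ratio)) => J.
(* The box is fitted to [J]: its longest word and, as letters stay strictly below [n], one more than
   its largest letter. *)
pose L := (\max_(u <- J) size u)%N; pose n := (\max_(u <- J) \max_(a <- u) a).+1%N.
apply: le_trans (word_box_bound n L).
rewrite (bigID positive_word) /= [X in _ + X]big1 ?addr0; last first.
  by move=> u /negbTE uN; rewrite /word_weight uN normr0.
rewrite -big_filter; apply: uniq_sum_le => // [|u].
  by rewrite filter_uniq ?fset_uniq.
rewrite mem_filter => /andP[/allP u_gt0 uJ]; apply: mem_word_box.
  exact: leq_bigmax_seq.
apply/allP => a au; rewrite u_gt0 //= ltnS.
apply: (@leq_trans (\max_(b <- u) b)); first exact: (@leq_bigmax_seq _ _ xpredT id).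
exact: (@leq_bigmax_seq _ _ xpredT (fun v : seq nat => \max_(b <- v) b)%N).
Qed.

(** Passes from sums indexed by the subtype of [A] to sums over all words, by reindexing along the
    injection [val]. *)
Lemma genfunE (A : set (seq nat)) : (forall u, A u -> positive_word u) ->
  genfun_cvg A z q /\ genfun A z q = set_sum word_weight A.
Proof.
move=> posA.
have weightE : weight z q = restr word_weight A \o (val : A -> seq nat).
  apply/funext => u; have uA := valP u.
  by rewrite /weight /restr /= uA /word_weight posA //; exact/set_mem.
have cvgA : genfun_cvg A z q.
  apply: complex_sum_cvg; have [M leM] := word_weight_bounded.
  exists M => J; apply: le_trans (leM [fset val u | u in J]%fset).
  rewrite big_imfset /=; last by move=> ? ? _ _; exact: val_inj.
  by apply: ler_sum => u _; rewrite weightE; exact: restr_norm_le.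
split=> //; apply/esym/set_sum_lim.
apply: (@partial_sum_reindex _ _ _ (val : A -> seq nat)); first exact: val_inj.
  move=> u; rewrite /restr; case: ifP => [uA _|]; last by rewrite eqxx.
  by exists (SigSub uA).
by rewrite -weightE.
Qed.

Lemma set_sum_cons (a : nat) (A : set (seq nat)) : (0 < a)%N ->
  set_sum word_weight (cons a @` A) = z * q ^+ a * set_sum word_weight A.
Proof.
move=> a_gt0; apply: set_sum_lim; apply: (@partial_sum_reindex _ _ _ (cons a)).
- by move=> u v [].
- move=> u; rewrite /restr; case: ifP => [/set_mem[v _ <-] _|]; first by exists v.
  by rewrite eqxx.
have -> : restr word_weight (cons a @` A) \o cons a
    = fun u => z * q ^+ a * restr word_weight A u.
  apply/funext => u /=; rewrite /restr.
  have -> : (a :: u \in cons a @` A) = (u \in A).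
    apply/idP/idP => [/set_mem[v Av [<-]]|/set_mem Au]; first exact/mem_set.
    by apply/mem_set; exists u.
  by case: ifP => _; rewrite ?mulr0 // word_weight_cons.
have -> : partial_sum (fun u => z * q ^+ a * restr word_weight A u)
    = fun J => z * q ^+ a * partial_sum (restr word_weight A) J.
  by apply/funext => J; rewrite /partial_sum mulr_sumr.
by apply: cvgMl_tmp; apply: set_sum_cvg; exact: word_weight_bounded.
Qed.

Local Notation gf := (set_sum word_weight).

(** * Recursions on the first letter *)

(* If [n] does not occur, [right_of n u] is [u]: so [tail_words 0 n] consists of
   the decreasing words with letters less than [n]. *)
Definition right_of (n : nat) (u : seq nat) : seq nat :=
  rev (take (index n (rev u)) (rev u)).

Definition left_of (n : nat) (u : seq nat) : seq nat := take (index n u) u.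

Lemma right_of_notin (n : nat) (u : seq nat) : n \notin u -> right_of n u = u.
Proof. by move=> nu; rewrite /right_of memNindex ?mem_rev // take_size revK. Qed.

Lemma right_of_cons (n a : nat) (u : seq nat) :
  (n \in u) || (a == n) -> right_of n (a :: u) = right_of n u.
Proof.
rewrite /right_of rev_cons -cats1 index_cat mem_rev.
case: (boolP (n \in u)) => [nu _|nu /= /eqP ->].
  by rewrite takel_cat // index_size.
rewrite /= eqxx addn0 take_size_cat // revK.
by rewrite -[RHS]/(right_of n u) right_of_notin.
Qed.

Lemma left_of_cons (n a : nat) (u : seq nat) :
  left_of n (a :: u) = if a == n then [::] else a :: left_of n u.
Proof. by rewrite /left_of /=; case: ifP. Qed.

Definition decreasing_words (n : nat) : set (seq nat) :=
  [set u | all (fun a => 0 < a < n)%N u && sorted geq u].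

Definition tail_words (k n : nat) : set (seq nat) :=
  [set u | [&& all (fun a => 0 < a <= n)%N u, count_mem n u == k
             & sorted geq (right_of n u)]].

(* At [m = 1] these are the multimodal sequences with [k] peaks of value [n]; the
   bound [m] on the left part is what the recursion peels off. *)
Definition peak_words (k n m : nat) : set (seq nat) :=
  [set u | [&& all (fun a => 0 < a <= n)%N u, count_mem n u == k,
               sorted geq (right_of n u), sorted leq (left_of n u)
             & all (leq m) (left_of n u)]].

(** The first letter is the largest: either it is [n], with an arbitrary word of the same kind
    behind it, or every letter is below [n]. *)
Lemma decreasing_words_rec (n : nat) : (0 < n)%N ->
  decreasing_words n.+1 = decreasing_words n `|` cons n @` decreasing_words n.+1.
Proof.
move=> n_gt0; have geq_trans : transitive geq by move=> ? ? ? /[swap]; exact: leq_trans.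
have consE a u : (decreasing_words n.+1 (a :: u) <->
    [/\ (0 < a <= n)%N, all (geq a) u & decreasing_words n.+1 u]).
  rewrite /decreasing_words /= path_sortedE //.
  split=> [/andP[/andP[-> ->] /andP[-> ->]] //|[-> -> /andP[-> ->]]] //.
apply/seteqP; split => [[|a u]|u].
- by left.
- move=> /[dup] decau /consE[/andP[a_gt0]]; rewrite leq_eqVlt => /orP[/eqP ->|ltan] leua decu.
    by right; exists u.
  left; move: decau => /andP[/= /andP[_ /allP un] sorted_au].
  apply/andP; split=> //=; rewrite a_gt0 ltan /=; apply/allP => b bu.
  have /andP[-> _] := un b bu.
  by apply: leq_ltn_trans ltan; exact: (allP leua).
- case=> [/andP[/allP un sorted_u]|[v decv <-]].
    apply/andP; split=> //; apply/allP => a /un /andP[-> /= ltan]; exact: ltnW.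
  apply/consE; split=> //; first by rewrite n_gt0 leqnn.
  by apply/allP => a av; move: decv => /andP[/allP /(_ a av) /andP[_]].
Qed.

Lemma tail_words0 (n : nat) : tail_words 0 n = decreasing_words n.
Proof.
apply/seteqP; split => u.
  move=> /and3P[/allP un /eqP count_u]; have nu : n \notin u by rewrite -has_pred1 has_count count_u.
  rewrite right_of_notin // => sorted_u; apply/andP; split=> //; apply/allP => a au.
  have /andP[-> /=] := un a au; rewrite leq_eqVlt => /orP[/eqP eqan|//].
  by move: nu; rewrite -eqan au.
move=> /andP[/allP un sorted_u].
have nu : n \notin u by apply/negP => /un; rewrite ltnn andbF.
apply/and3P; split; rewrite ?right_of_notin //; last first.
  by rewrite eqn0Ngt -has_count has_pred1.
by apply/allP => a /un /andP[-> /ltnW].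
Qed.

(** A leading [n] uses up one peak. A smaller leading letter still has a peak behind it, so it is
    unconstrained and leaves [right_of] unchanged. *)
Lemma tail_words_rec (k n : nat) : (0 < n)%N ->
  tail_words k.+1 n = cons n @` tail_words k n `|`
    \bigcup_(a in [set a | (1 <= a < n)%N]) (cons a @` tail_words k.+1 n).
Proof.
move=> n_gt0; have in_of k' u : count_mem n u = k'.+1 -> n \in u.
  by move=> count_u; rewrite -has_pred1 has_count count_u.
apply/seteqP; split => [[|a u]|u].
- by case/and3P.
- move=> /and3P[/= /andP[/andP[a_gt0 lean] un]].
  have [-> |neq_an] := eqVneq a n.
    rewrite right_of_cons ?eqxx ?orbT // => count_u sorted_u.
    by left; exists u => //; apply/and3P.
  rewrite add0n => /eqP count_u; rewrite right_of_cons ?(in_of _ _ count_u) // => sorted_u.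
  right; exists a; first by rewrite /= a_gt0 ltn_neqAle neq_an.
  by exists u => //; apply/and3P; rewrite count_u.
- case=> [[v /and3P[vn count_v sorted_v] <-]|[a /= /andP[a_gt0 ltan]
      [v /and3P[vn /eqP count_v sorted_v] <-]]]; apply/and3P.
    by rewrite /= n_gt0 leqnn eqxx add1n eqSS right_of_cons ?eqxx ?orbT.
  rewrite /= a_gt0 ltnW //= (ltn_eqF ltan) add0n count_v.
  by rewrite right_of_cons ?(in_of _ _ count_v).
Qed.

(** Letters before the first [n] would be both below [n] and at least [n], so the left part is empty
    and the word starts with its first peak. *)
Lemma peak_words_top (k n : nat) : (0 < n)%N ->
  peak_words k.+1 n n = cons n @` tail_words k n.
Proof.
move=> n_gt0; apply/seteqP; split => [[|a u]|_ [v /and3P[vn count_v sorted_v] <-]].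
- by case/and5P.
- move=> /and5P[/= /andP[/andP[_ lean] un]]; rewrite left_of_cons.
  have [-> |neq_an _ _ _ /= /andP[lena _]] := eqVneq a n; last first.
    by move: neq_an; rewrite eqn_leq lean lena.
  rewrite right_of_cons ?eqxx ?orbT // => count_u sorted_u _ _.
  by exists u => //; apply/and3P.
- apply/and5P; rewrite /= n_gt0 leqnn eqxx add1n eqSS left_of_cons eqxx.
  by rewrite right_of_cons ?eqxx ?orbT.
Qed.

(** The left part increases, so its first letter is its minimum: either it is [m] and can be
    removed, or all of the left part exceeds [m]. A word starting with [n] has an empty left part
    and falls in the second case. *)
Lemma peak_words_rec (k n m : nat) : (0 < m < n)%N ->
  peak_words k.+1 n m = peak_words k.+1 n m.+1 `|` cons m @` peak_words k.+1 n m.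
Proof.
move=> /andP[m_gt0 ltmn]; have in_of k' u : count_mem n u = k'.+1 -> n \in u.
  by move=> count_u; rewrite -has_pred1 has_count count_u.
have path_leq a u : path leq a u = all (leq a) u && sorted leq u.
  by rewrite path_sortedE //; exact: leq_trans.
apply/seteqP; split => [[|a u]|u].
- by case/and5P.
- move=> /[dup] peak_au /and5P[/= /andP[/andP[a_gt0 lean] un]].
  have [eq_an _ _ _ _|neq_an] := eqVneq a n.
    left; move: peak_au => /and5P[H1 H2 H3 _ _]; apply/and5P; split=> //;
      by rewrite left_of_cons eq_an eqxx.
  rewrite add0n left_of_cons (negbTE neq_an) /= path_leq.
  move=> /eqP count_u; rewrite right_of_cons ?(in_of _ _ count_u) //.
  move=> sorted_r /andP[leau sorted_l] /andP[lema lemu].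
  have [eq_ma|neq_ma] := eqVneq m a.
    by right; exists u; [apply/and5P; rewrite count_u | rewrite eq_ma].
  have ltma : (m < a)%N by rewrite ltn_neqAle neq_ma.
  left; move: peak_au => /and5P[H1 H2 H3 H4 _]; apply/and5P; split=> //.
  rewrite left_of_cons (negbTE neq_an) /= ltma; apply/allP => b bu.
  by apply: leq_trans ltma _; exact: (allP leau).
- case=> [/and5P[H1 H2 H3 H4 /allP H5]|[v /and5P[H1 /eqP H2 H3 H4 H5] <-]]; apply/and5P.
    by split=> //; apply/allP => b /H5 /ltnW.
  rewrite /= m_gt0 ltnW //= (ltn_eqF ltmn) add0n H2 right_of_cons ?(in_of _ _ H2) //.
  by rewrite left_of_cons (ltn_eqF ltmn) /= leqnn path_leq H5.
Qed.

(** * Solving the recursions for the generating functions *)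

Lemma trivIset_cons (A : set (seq nat)) : trivIset setT (fun a => cons a @` A).
Proof. by move=> a b _ _ [u [[v _ <-] [w _ [->]]]]. Qed.

(** The recursion reads [x = y + c * x], that is [x * (1 - c) = y], and supplies one factor of
    [qpoch] per step. The product form postpones division to [gf_peak_words]. *)
Lemma gf_decreasing_words (n : nat) : gf (decreasing_words n.+1) * qpoch (z * q) q n = 1.
Proof.
elim: n => [|n IHn].
  have -> : decreasing_words 1 = [set [::]].
    apply/seteqP; split => [[|a u]|_ ->] //=.
    by rewrite /decreasing_words /= ltnS; case: a.
  by rewrite set_sum1 /qpoch big_geq // mulr1 /word_weight /= !expr0 mulr1.
have recE : gf (decreasing_words n.+2)
    = gf (decreasing_words n.+1) + z * q ^+ n.+1 * gf (decreasing_words n.+2).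
  rewrite -set_sum_cons // -set_sumU; last 2 first.
  - exact: word_weight_bounded.
  - rewrite -subset0 => _ [/[swap] -[v _ <-]].
    by rewrite /decreasing_words /= ltnn.
  by rewrite -decreasing_words_rec.
rewrite /qpoch big_nat_recr //= -/(qpoch _ _ _) -mulrA -exprS mulrCA mulrC.
have -> : gf (decreasing_words n.+2) * (1 - z * q ^+ n.+1) = gf (decreasing_words n.+1).
  by rewrite mulrBr mulr1 {1}recE mulrC addrK.
exact: IHn.
Qed.

Lemma qbraceE (n : nat) :
  qbrace (z * q) q n = 1 - \sum_(1 <= a < n.+1) z * q ^+ a.
Proof.
rewrite /qbrace big_add1 mulr_sumr /=.
by under eq_bigr do rewrite -mulrA -exprS.
Qed.

(** Each peak of such a word ends a free stretch of smaller letters, whence one [qbrace] per peak;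
    the final decreasing part accounts for [qpoch]. *)
Lemma gf_tail_words (k n : nat) :
  gf (tail_words k n.+1) * (qbrace (z * q) q n ^+ k * qpoch (z * q) q n)
    = (z * q ^+ n.+1) ^+ k.
Proof.
elim: k => [|k IHk]; first by rewrite tail_words0 !expr0 mul1r gf_decreasing_words.
have recE : gf (tail_words k.+1 n.+1) = z * q ^+ n.+1 * gf (tail_words k n.+1)
    + (\sum_(1 <= a < n.+1) z * q ^+ a) * gf (tail_words k.+1 n.+1).
  rewrite {1}tail_words_rec // set_sumU; first last.
  - rewrite -subset0 => _ [[u _ <-] [a /= /andP[_ ltan] [v _ [eqan _]]]].
    by move: ltan; rewrite eqan ltnn.
  - exact: word_weight_bounded.
  rewrite set_sum_cons // set_sum_bigcup_finite; last 2 first.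
  - exact: word_weight_bounded.
  - exact: trivIset_cons.
  congr (_ + _); rewrite mulr_suml; apply: eq_big_nat => a /andP[a_gt0 _].
  exact: set_sum_cons.
have stepE : gf (tail_words k.+1 n.+1) * qbrace (z * q) q n
    = z * q ^+ n.+1 * gf (tail_words k n.+1).
  by rewrite qbraceE mulrBr mulr1 [X in X - _]recE [X in _ - X]mulrC addrK.
by rewrite exprS -mulrA mulrA stepE -mulrA IHk -exprS.
Qed.

Lemma gf_peak_words (k n : nat) : (0 < k)%N -> (0 < n)%N ->
  gf (peak_words k n 1) = peak_term z q k n.
Proof.
case: k n => [|k] [|n] // _ _.
(* Induction lowering the bound on the left part from [n.+1], where that part is empty, down to 1;
   each bound [a] passed contributes the factor [1 - z * q ^+ a]. *)
have recE m : (m <= n)%N ->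
    gf (peak_words k.+1 n.+1 (n.+1 - m)) * \prod_(n.+1 - m <= a < n.+1) (1 - z * q ^+ a)
      = z * q ^+ n.+1 * gf (tail_words k n.+1).
  elim: m => [|m IHm] lemn.
    by rewrite subn0 big_geq // mulr1 peak_words_top // set_sum_cons.
  rewrite -IHm 1?ltnW // subSS.
  have -> : (n.+1 - m = (n - m).+1)%N by rewrite subSn // ltnW.
  have lt0nm : (0 < n - m < n.+1)%N by rewrite subn_gt0 lemn ltnS leq_subr.
  rewrite big_ltn; last by case/andP: lt0nm.
  rewrite mulrA; congr (_ * _).
  rewrite mulrBr mulr1 {1}peak_words_rec // set_sumU; first last.
  - rewrite -subset0 => _ [/[swap] -[v _ <-]].
    rewrite /peak_words /= left_of_cons; case: (eqVneq (n - m)%N n.+1) => [eqn|_ /=].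
      by move: lt0nm; rewrite eqn ltnn andbF.
    by rewrite ltnn /= !andbF.
  - exact: word_weight_bounded.
  rewrite set_sum_cons; last by case/andP: lt0nm.
  by rewrite mulrC addrK.
have := recE n (leqnn n); rewrite subSnn big_add1 /=.
have -> : \prod_(0 <= a < n) (1 - z * q ^+ a.+1) = qpoch (z * q) q n.
  by rewrite /qpoch; apply: eq_bigr => a _; rewrite -mulrA -exprS.
move=> peakE.
have qpoch_neq0 : qpoch (z * q) q n != 0.
  rewrite /qpoch prodf_seq_neq0; apply/allP => a _ /=.
  by rewrite -mulrA -exprS letter_neq1.
have qbrace_neq0 : qbrace (z * q) q n != 0.
  by rewrite qbraceE letters_neq1.
rewrite /peak_term /= mulnC exprM -exprMn; apply: canRL (mulfK _) _.
  by rewrite mulf_neq0 // expf_neq0.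
(* One [qpoch] comes from the left part, the other from the tail. The tail behind the first of the
   [k.+1] peaks has only [k] peaks, hence [k] factors [qbrace]. *)
have -> : qbrace (z * q) q n ^+ k * qpoch (z * q) q n ^+ 2
    = qpoch (z * q) q n * (qbrace (z * q) q n ^+ k * qpoch (z * q) q n).
  by rewrite expr2 mulrCA.
by rewrite 3!mulrA peakE -mulrA -[LHS]mulrA gf_tail_words -exprS.
Qed.

(** * Multimodal sequences classified by peak value *)

Lemma peak_rev (u : seq nat) : peak (rev u) = peak u.
Proof. by apply: perm_big; rewrite perm_rev. Qed.

Lemma peak_peak_words (k n m : nat) (u : seq nat) : (0 < k)%N ->
  peak_words k n m u -> peak u = n.
Proof.
move=> k_gt0 /and5P[/allP un /eqP count_u _ _ _]; apply/eqP; rewrite eqn_leq.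
apply/andP; split; first by apply/bigmax_leqP_seq => a /un /andP[].
have nu : n \in u by rewrite -has_pred1 has_count count_u.
exact: (@leq_bigmax_seq _ _ xpredT id).
Qed.

(** The index [n] is the peak value, and with [m = 1] the bound on the left part is mere
    positivity. *)
Lemma multimodal_k_bigcup (k : nat) : (0 < k)%N ->
  multimodal_k k = \bigcup_(n in [set n | (1 <= n)%N]) peak_words k n 1.
Proof.
move=> k_gt0; apply/seteqP; split => [u|u [n _]].
  move=> /and5P[_ /allP u_gt0 count_u sorted_l sorted_r]; exists (peak u).
    have : has (pred1 (peak u)) u by rewrite has_count (eqP count_u).
    by rewrite has_pred1 => /u_gt0.
  apply/and5P; split=> //.
  - by apply/allP => a au; rewrite u_gt0 //=; exact: (@leq_bigmax_seq _ _ xpredT id).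
  (* [right_part] computes the peak of the reversed word. *)
  - by rewrite /right_of -[X in index X]peak_rev.
  - by apply/allP => a /mem_take /u_gt0.
move=> /[dup] /(peak_peak_words k_gt0) peak_u /and5P[/allP un count_u sorted_r sorted_l _].
apply/and5P; rewrite /left_part /right_part /left_part peak_u; split=> //.
(* The empty word has no peak, whereas [k] is positive. *)
- by case: u count_u {un sorted_r sorted_l peak_u} => //= /eqP k0; move: k_gt0; rewrite -k0.
- by apply/allP => a /un /andP[].
- by rewrite peak_rev peak_u.
Qed.

Lemma trivIset_peak_words (k : nat) : (0 < k)%N ->
  trivIset setT (fun n => peak_words k n 1).
Proof.
move=> k_gt0 n n' _ _ [u [/(peak_peak_words k_gt0) <- /(peak_peak_words k_gt0) <-]].
by [].
Qed.

Lemma trivIset_multimodal_k : trivIset setT multimodal_k.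
Proof.
by move=> k k' _ _ [u [/and5P[_ _ /eqP <- _ _] /and5P[_ _ /eqP <- _ _]]].
Qed.

End Words.

Theorem theorem4 (R : realType) (z q : Cplx R)
    (hq : `|q| < 1 / (1 + `|z|)) :
  (forall k : nat, (1 <= k)%N ->
    [/\ genfun_cvg (multimodal_k k) z q,
        cvgn (fun N => \sum_(1 <= n < N) peak_term z q k n) &
        genfun (multimodal_k k) z q = \sum_(1 <= n <oo) peak_term z q k n])
  /\
  [/\ genfun_cvg multimodal z q,
      cvgn (fun K => \sum_(1 <= k < K) \sum_(1 <= n <oo) peak_term z q k n) &
      genfun multimodal z q
        = \sum_(1 <= k <oo) \sum_(1 <= n <oo) peak_term z q k n].
Proof.
have bounded := word_weight_bounded hq.
have positive k u : multimodal_k k u -> positive_word u by case/and5P.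
(* For fixed [k], countable additivity over the peak value [n]. *)
have series_k k : (1 <= k)%N ->
    (fun N => \sum_(1 <= n < N) peak_term z q k n) @ \oo
      --> set_sum (word_weight z q) (multimodal_k k).
  move=> k_gt0.
  have -> : (fun N => \sum_(1 <= n < N) peak_term z q k n)
      = fun N => \sum_(1 <= n < N) set_sum (word_weight z q) (peak_words k n 1).
    apply/funext => N; apply: eq_big_nat => n /andP[n_gt0 _].
    by rewrite gf_peak_words.
  have cvg_U := @set_sum_bigcup _ _ _ bounded _ _ 1%N
    (trivIset_peak_words k_gt0) (multimodal_k_bigcup k_gt0).
  exact cvg_U.
have lim_k k : (1 <= k)%N ->
    \sum_(1 <= n <oo) peak_term z q k n = set_sum (word_weight z q) (multimodal_k k).
  by move=> /series_k /cvg_lim; apply; exact: norm_hausdorff.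
split=> [k k_gt0|].
  have [cvg_k ->] := genfunE hq (@positive k).
  split; [exact cvg_k | | by rewrite lim_k].
  exact (cvgP _ (series_k k k_gt0)).
have [|cvg_all ->] := @genfunE _ _ _ hq multimodal.
  by move=> u [k _]; exact: positive.
(* Countable additivity once more, now over the number of peaks. *)
have series_all : (fun K => \sum_(1 <= k < K) \sum_(1 <= n <oo) peak_term z q k n) @ \oo
    --> set_sum (word_weight z q) multimodal.
  have -> : (fun K => \sum_(1 <= k < K) \sum_(1 <= n <oo) peak_term z q k n)
      = fun K => \sum_(1 <= k < K) set_sum (word_weight z q) (multimodal_k k).
    apply/funext => K; apply: eq_big_nat => k /andP[k_gt0 _].
    by rewrite lim_k.
  have cvg_U := @set_sum_bigcup _ _ _ bounded _ multimodal 1%N trivIset_multimodal_k erefl.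
  exact cvg_U.
split; [exact cvg_all | exact (cvgP _ series_all) |].
apply: esym; move: series_all => /cvg_lim; apply; exact: norm_hausdorff.
Qed.
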